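(* Let $d\ge 2$ and let $f:[0,1]^d\to\mathbb{R}$ be continuous and bounded by a sum of integrable functions. For $n\ge 1$ and $i=(i_1,\dots,i_d)\in\{1,\dots,n\}^d$ let $$I_i^n=\left[\tfrac{i_1-1}{n},\tfrac{i_1}{n}\right)\times\cdots\times\left[\tfrac{i_d-1}{n},\tfrac{i_d}{n}\right),$$ and define $$f_n^{\max}(x)=\sup_{y\in I_i^n}f(y),\qquad f_n^{\min}(x)=\inf_{y\in I_i^n}f(y)\qquad\text{for all }x\in I_i^n,\ i\in\{1,\dots,n\}^d.$$ For each $n\ge1$ let $C_n^{\max}$ and $C_n^{\min}$ be $d$-copulas which attain the minimum in $$\min_{C\in\mathcal{C}^d}\int_{[0,1]^d}f_n^{\max}(x)\,dC(x)\qquad\text{and}\qquad \min_{C\in\mathcal{C}^d}\int_{[0,1]^d}f_n^{\min}(x)\,dC(x),$$ respectively. Then $$\lim_{n\to\infty}\int_{[0,1]^d}f_n^{\min}(x)\,dC_n^{\min}(x)=\lim_{n\to\infty}\int_{[0,1]^d}f_n^{\max}(x)\,dC_n^{\max}(x)=\inf_{C\in\mathcal{C}^d}\int_{[0,1]^d}f(x)\,dC(x).$$ Furthermore, each of the sequences $(C_n^{\max})_{n\ge1}$ and $(C_n^{\min})_{n\ge1}$ has a subsequence which converges weakly to a minimizer $C^*\in\mathcal{C}^d$ of the problem $$\min_{C\in\mathcal{C}^d}\int_{[0,1]^d}f(x)\,dC(x).$$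
   Context: A function $C:[0,1]^d\to[0,1]$ is a $d$-copula if there is a random vector $(U_1,\dots,U_d)$, each $U_k$ uniformly distributed on $[0,1]$, with $C(u_1,\dots,u_d)=\mathbb{P}(U_1\le u_1,\dots,U_d\le u_d)$ for all $u_1,\dots,u_d\in[0,1]$. $\mathcal{C}^d$ denotes the set of all $d$-copulas. Each $d$-copula $C$ corresponds to a unique Borel probability measure $\mu_C$ on $[0,1]^d$, all of whose one-dimensional marginals are Lebesgue measure on $[0,1]$, via $C(x_1,\dots,x_d)=\mu_C([0,x_1]\times\cdots\times[0,x_d])$. The integral $\int f\,dC$ means $\int f\,d\mu_C$, and weak convergence of copulas means weak convergence of the corresponding measures. The functions $f_n^{\max},f_n^{\min}$ are defined on $[0,1)^d$; its complement in $[0,1]^d$ is a null set for every $\mu_C$, so the values there are irrelevant to the integrals. ''Bounded by a sum of integrable functions'' means that there are Lebesgue integrable functions $g_1,\dots,g_d:[0,1]\to\mathbb{R}$ with $|f(x_1,\dots,x_d)|\le g_1(x_1)+\cdots+g_d(x_d)$ for all $(x_1,\dots,x_d)\in[0,1]^d$. *)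

(* Defs.v *)
From HB Require Import structures.
From mathcomp Require Import all_boot all_order all_algebra.
From mathcomp Require Import all_classical all_reals all_analysis.

Set Implicit Arguments.
Unset Strict Implicit.
Unset Printing Implicit Defensive.

Import Order.TTheory GRing.Theory Num.Theory.
Import numFieldNormedType.Exports.

Local Open Scope classical_set_scope.
Local Open Scope ring_scope.

(* R^d with its Borel sigma-algebra; definitionally the type 'rV[R]_d. *)
Definition borelRd (R : realType) (d : nat) :=
  g_sigma_algebraType (@open 'rV[R]_d).

Definition unit_cube {R : realType} {d : nat} : set 'rV[R]_d :=
  [set x | forall k, 0 <= x ord0 k <= 1].

(* Functions on [0,1]^d (copulas, cost functions) are total functions on
   'rV[R]_d; only their values on [0,1]^d are ever used. *)
Definition is_copula (R : realType) (d : nat) (C : 'rV[R]_d -> R) : Prop :=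
  exists (disp : measure_display) (Omega : measurableType disp)
         (P : probability Omega R) (U : 'I_d -> {RV P >-> R}),
    (forall k (A : set R), measurable A ->
       distribution P (U k) A = uniform_prob (@ltr01 R) A) /\
    (forall u, unit_cube u ->
       (C u)%:E = P [set w | forall k, U k w <= u ord0 k]).

(* A measure on [0,1]^d is encoded as a measure on R^d; the condition on the
   marginals forces it to be concentrated on [0,1]^d. *)
Definition is_copula_measure (R : realType) (d : nat) (C : 'rV[R]_d -> R)
    (mu : probability (borelRd R d) R) : Prop :=
  (forall k (A : set R), measurable A ->
     mu [set x : 'rV[R]_d | A (x ord0 k)] = uniform_prob (@ltr01 R) A) /\
  (forall x, unit_cube x ->
     mu [set y : 'rV[R]_d | forall k, 0 <= y ord0 k <= x ord0 k] = (C x)%:E).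

(* mu_C; get picks an arbitrary probability when C is not a copula. *)
Definition copula_measure (R : realType) (d : nat) (C : 'rV[R]_d -> R) :
    probability (borelRd R d) R :=
  get [set mu | is_copula_measure C mu].

Definition copula_integral (R : realType) (d : nat) (f : 'rV[R]_d -> R)
    (C : 'rV[R]_d -> R) : \bar R :=
  (\int[copula_measure C]_(x in (unit_cube : set 'rV[R]_d)) (f x)%:E)%E.

Definition is_minimizer (R : realType) (d : nat) (f C : 'rV[R]_d -> R) : Prop :=
  is_copula C /\
  forall C', is_copula C' -> (copula_integral f C <= copula_integral f C')%E.

Definition copula_weak_cvg (R : realType) (d : nat)
    (C_ : nat -> 'rV[R]_d -> R) (C : 'rV[R]_d -> R) : Prop :=
  forall h : 'rV[R]_d -> R, {within unit_cube, continuous h} ->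
    copula_integral h (C_ n) @[n --> \oo] --> copula_integral h C.

Definition bounded_by_sum (R : realType) (d : nat) (f : 'rV[R]_d -> R) : Prop :=
  exists g : 'I_d -> R -> R,
    (forall k, (@lebesgue_measure R).-integrable `[0, 1] (EFin \o g k)) /\
    (forall x, unit_cube x -> `|f x| <= \sum_(k < d) g k (x ord0 k)).

(* Indices are 0-based: i k ranges over 0, ..., n-1. *)
Definition cell (R : realType) (d n : nat) (i : {ffun 'I_d -> 'I_n}) :
    set 'rV[R]_d :=
  [set x | forall k, (i k)%:R / n%:R <= x ord0 k < (i k).+1%:R / n%:R].

(* The cells are disjoint and cover [0,1)^d; the value outside is set to 0. *)
Definition fmax (R : realType) (d : nat) (f : 'rV[R]_d -> R) (n : nat)
    (x : 'rV[R]_d) : R :=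
  if [pick i : {ffun 'I_d -> 'I_n} | x \in cell i] is Some i
  then sup (f @` cell i) else 0.

Definition fmin (R : realType) (d : nat) (f : 'rV[R]_d -> R) (n : nat)
    (x : 'rV[R]_d) : R :=
  if [pick i : {ffun 'I_d -> 'I_n} | x \in cell i] is Some i
  then inf (f @` cell i) else 0.

(* Main.v *)
(* On the compact cube, f is uniformly continuous, so f_n^max and f_n^min are
   uniformly close to f on [0,1)^d, which has full measure for every copula; the
   integrals against any copula are then uniformly close as well.  Every weak
   limit of minimizers of the approximate problems is therefore a minimizer for
   f, and the minimal values converge, so everything reduces to the weak
   sequential compactness of the set of copulas.

   For compactness, encode x in the cube by the infinite binary sequence that
   records which rational thresholds are reached by which coordinates of x.
   Along a subsequence the masses of all the cells cut out by finite binary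
   strings converge.  The limit masses are realised on [0,1) by nested intervals
   of the corresponding lengths.  The cells met by a point w of [0,1) shrink to a
   single point X(w) of the cube, and the law of X under the uniform
   distribution is the weak limit.  No mass is lost, because a continuous
   function is uniformly approximated by functions constant on the cells. *)
Require Import Defs.
From HB Require Import structures.
From mathcomp Require Import all_boot all_order all_algebra.
From mathcomp Require Import all_classical all_reals all_analysis.
From mathcomp Require Import measurable_realfun lra.
Set Implicit Arguments.
Unset Strict Implicit.
Unset Printing Implicit Defensive.
Import Order.TTheory GRing.Theory Num.Theory.
Import numFieldNormedType.Exports.
Local Open Scope classical_set_scope.
Local Open Scope ring_scope.

(** * Measurability in R^d *)

(** Density of the rationals: all the rational boxes contained in [O] are taken. The index type is
    countable, so measurability questions about open sets reduce to boxes, hence to single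
    coordinates. *)
Lemma open_rV_rational_boxes (R : realType) (d : nat) (O : set 'rV[R]_d) :
  open O -> exists J : set ('rV[rat]_d * nat),
    O = \bigcup_(j in J)
          [set x : 'rV[R]_d | forall k, `|x ord0 k - ratr (j.1 ord0 k)| < j.2.+1%:R^-1].
Proof.
move=> oO.
exists [set j : 'rV[rat]_d * nat | [set x : 'rV[R]_d | forall k,
    `|x ord0 k - ratr (j.1 ord0 k)| < j.2.+1%:R^-1] `<=` O].
apply/seteqP; split => [x Ox|x [j /= jO xj]]; last exact: jO.
have /nbhs_ballP[e /= e0 eO] : nbhs x O by exact: open_nbhs_nbhs.
(* Two points of one box differ by less than twice its radius in each coordinate, so the box around
   [x] stays inside the ball of radius [e]. *)
have [m m0 me] : exists2 m : nat, True & (2 : R) * m.+1%:R^-1 < e.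
  exists (Num.truncn (2 / e)) => //.
  by rewrite ltr_pdivrMr // mulrC -ltr_pdivrMr // truncnS_gt.
have m1 : (0 : R) < m.+1%:R^-1 by rewrite invr_gt0.
have /choice[q xq] : forall k : 'I_d, exists q : rat,
    `|x ord0 k - ratr q| < m.+1%:R^-1.
  move=> k.
  have [|q] := @rat_in_itvoo R (x ord0 k - m.+1%:R^-1) (x ord0 k).
    by rewrite ltrBlDr ltrDl.
  rewrite in_itv /= => /andP[q1 q2]; exists q.
  by rewrite ger0_norm ?subr_ge0 ?(ltW q2)// ltrBlDr -ltrBlDl.
exists (\row_k q k, m) => /=; last by move=> k; rewrite mxE; exact: xq.
move=> y yq; apply: eO; split => // i k; rewrite ord1.
have := yq k; rewrite mxE => yqk; have xqk := xq k.
rewrite /ball /= (_ : _ - _ = (x ord0 k - ratr (q k)) - (y ord0 k - ratr (q k))).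
  apply: le_lt_trans me; apply: le_trans (ler_normB _ _) _.
    by rewrite mulr_natl mulr2n ltW// ltrD.
by rewrite opprB addrA subrK.
Qed.

Lemma measurable_fun_borelRd (R : realType) (d : nat) (disp : measure_display)
    (T : measurableType disp) (U : T -> borelRd R d) :
  (forall k, measurable_fun setT (fun w => (U w : 'rV[R]_d) ord0 k)) ->
  measurable_fun setT U.
Proof.
move=> mU; apply: (@measurability _ _ _ (borelRd R d) _ _ (@open 'rV[R]_d)) => //.
move=> _ [V oV <-]; have [J ->] := open_rV_rational_boxes oV.
rewrite setTI preimage_bigcup bigcup_mkcond.
apply: countable_bigcupT_measurable => [|j]; first exact: countableP.
case: ifPn => // _.
rewrite (_ : _ @^-1` _ = \bigcap_k [set w |
    `|(U w : 'rV[R]_d) ord0 k - ratr (j.1 ord0 k)| < j.2.+1%:R^-1]); last first.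
  by apply/seteqP; split => w /= h k //=; exact: h.
apply: fin_bigcap_measurable => // k _.
have mN : measurable_fun setT (fun w =>
    `|(U w : 'rV[R]_d) ord0 k - ratr (j.1 ord0 k)|).
  apply: (@measurableT_comp _ _ _ _ _ _ (@Num.norm R R)) => //.
  exact: measurable_funB.
have := mN measurableT `]-oo, (j.2.+1%:R^-1 : R)[%classic (measurable_itv _).
by rewrite setTI; congr measurable; apply/seteqP; split => w /=; rewrite in_itv.
Qed.

Lemma measurable_coord (R : realType) (d : nat) (k : 'I_d) :
  measurable_fun setT (fun x : borelRd R d => (x : 'rV[R]_d) ord0 k).
Proof.
apply: (measurability (@RGenOpens.G R)); first exact: RGenOpens.measurableE.
move=> _ [_ [a [b ->]] <-]; rewrite setTI; apply: sub_sigma_algebra.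
apply: open_comp; last exact: interval_open.
by move=> x _; exact: coord_continuous.
Qed.

(** * Integrals of bounded functions *)

Lemma bounded_integrable (R : realType) (disp : measure_display)
    (T : measurableType disp) (P : probability T R) (D : set T) (g : T -> R)
    (M : R) :
  measurable D -> measurable_fun D g -> (forall x, D x -> `|g x| <= M) ->
  P.-integrable D (EFin \o g).
Proof.
move=> mD mg gM; apply: measurable_bounded_integrable => //.
  by apply: le_lt_trans (probability_le1 P mD) _; rewrite ltry.
exists M; split; first by rewrite num_real.
by move=> K MK x /= Dx; apply: le_trans (gM x Dx) (ltW MK).
Qed.

Lemma Rintegral_full (R : realType) (disp : measure_display)
    (T : measurableType disp) (P : probability T R) (D D' : set T) (g : T -> R) :
  measurable D -> measurable D' -> D' `<=` D -> P D' = 1%E ->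
  P.-integrable D (EFin \o g) ->
  \int[P]_(x in D) g x = \int[P]_(x in D') g x.
Proof.
move=> mD mD' D'D PD' ig; rewrite /Rintegral.
have PC : P (~` D') = 0%E by rewrite probability_setC// PD' subee.
rewrite (@negligible_integral _ _ _ P D (~` D')) //.
- by rewrite setDE setCK setIidr.
- exact: measurableC.
Qed.

(** The bound is asked for only on a subset [D'] of full measure, because step functions on
    half-open cells approximate [f] on the half-open cube but not on the faces where a coordinate is
    1. *)
Lemma Rintegral_close (R : realType) (disp : measure_display)
    (T : measurableType disp) (P : probability T R) (D D' : set T)
    (g1 g2 : T -> R) (e : R) :
  measurable D -> measurable D' -> D' `<=` D -> P D' = 1%E ->
  P.-integrable D (EFin \o g1) -> P.-integrable D (EFin \o g2) ->
  (forall x, D' x -> `|g1 x - g2 x| <= e) ->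
  `|\int[P]_(x in D) g1 x - \int[P]_(x in D) g2 x| <= e.
Proof.
move=> mD mD' D'D PD' i1 i2 ge.
have i1' : P.-integrable D' (EFin \o g1) by exact: integrableS i1.
have i2' : P.-integrable D' (EFin \o g2) by exact: integrableS i2.
have i12 : P.-integrable D' (EFin \o (g1 \- g2)) by exact: (integrableB mD' i1' i2').
rewrite (Rintegral_full _ mD' D'D)// (Rintegral_full _ mD' D'D)//.
rewrite -RintegralB//; apply: le_trans (le_normr_Rintegral mD' i12) _.
have -> : e = \int[P]_(x in D') e by rewrite Rintegral_cst// [X in fine X](_ : _ = 1%E) ?mulr1.
apply: le_Rintegral => //.
- exact: (integrable_norm i12).
- by apply: (@bounded_integrable _ _ _ _ _ _ `|e|).
Qed.

Lemma probabilityE_fine (R : realType) (disp : measure_display)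
    (T : measurableType disp) (P : probability T R) (A : set T) :
  measurable A -> (fine (P A))%:E = P A.
Proof. by move=> mA; rewrite fineK// fin_num_measure. Qed.

(** [g \o X] is a finite linear combination of indicators of the fibres of [X]. *)
Lemma Rintegral_simple (R : realType) (disp : measure_display)
    (T : measurableType disp) (P : probability T R) (I : finType)
    (X : T -> I) (g : I -> R) :
  (forall i, measurable [set x | X x = i]) ->
  P.-integrable setT (EFin \o (g \o X)) /\
  \int[P]_x g (X x) = \sum_i g i * fine (P [set x | X x = i]).
Proof.
move=> mX.
have gX : g \o X = fun x => \sum_i g i * \1_[set x | X x = i] x.
  apply/funext => x /=; rewrite (bigD1 (X x))//= indicE mem_set//= mulr1.
  rewrite big1 ?addr0// => i iX; rewrite indicE memNset ?mulr0// => /= Xi.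
  by rewrite Xi eqxx in iX.
have int1 i : P.-integrable setT (fun x => (g i * \1_[set x | X x = i] x)%:E).
  apply: (@bounded_integrable _ _ _ _ _ (fun x => g i * \1_[set x | X x = i] x) `|g i|) => //.
    by apply: measurable_funM => //; exact: measurable_indic.
  move=> x _; rewrite normrM ler_piMr// indicE; case: (_ \in _) => //=.
    by rewrite normr1.
  by rewrite normr0 ler01.
have gXE : EFin \o (g \o X) =
    fun x => (\sum_(i <- index_enum I) (g i * \1_[set x | X x = i] x)%:E)%E.
  by rewrite gX; apply/funext => x /=; rewrite sumEFin.
split; first by rewrite gXE; exact: integrable_sum.
rewrite /Rintegral (_ : (fun x => _) = EFin \o (g \o X))//.
rewrite gXE integral_sum// -sum_fine; last first.
  by move=> i _; exact: integrable_fin_num.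
apply: eq_bigr => i _; rewrite -[LHS]/(\int[P]_x _) RintegralZl//; last first.
  apply: (@bounded_integrable _ _ _ _ _ (\1_[set x | X x = i]) 1) => //.
  move=> x _; rewrite indicE; case: (_ \in _); rewrite ?normr1 ?normr0//.
by rewrite /Rintegral integral_indic// setIT.
Qed.

(** * A process with prescribed binary string probabilities *)

Lemma probability_setI_full (R : realType) (disp : measure_display)
    (T : measurableType disp) (P : probability T R) (A D : set T) :
  measurable A -> measurable D -> P D = 1%E -> P (A `&` D) = P A.
Proof.
move=> mA mD PD.
have PDC : P (~` D) = 0%E by rewrite probability_setC// PD subee.
have PAD : P (A `\` D) = 0%E.
  apply: (@subset_measure0 _ _ _ P _ (~` D)).
  - exact: measurableD.
  - exact: measurableC.
  - by move=> x [].
  - exact: PDC.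
rewrite [RHS](measureDI P mA mD) -[LHS]add0e.
by congr (_ + _)%E; rewrite -PAD.
Qed.

Lemma uniform_probE (R : realType) (A : set R) : measurable A ->
  uniform_prob (@ltr01 R) A = lebesgue_measure (A `&` `[0, 1]).
Proof.
move=> mA; rewrite /uniform_prob integral_uniform_pdf.
rewrite (eq_integral (fun=> 1%:E)); last first.
  move=> x; rewrite inE/= in_itv/= /uniform_pdf => -[_ ->].
  by rewrite subr0 invr1.
by rewrite integral_cst ?mul1e//; exact: measurableI.
Qed.

Lemma uniform_prob_itvco (R : realType) (a b : R) : 0 <= a -> a <= b -> b <= 1 ->
  uniform_prob (@ltr01 R) `[a, b[%classic = (b - a)%:E.
Proof.
move=> a0 ab b1; rewrite uniform_probE; last exact: measurable_itv.
rewrite setIidl; last first.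
  move=> x /=; rewrite !in_itv /= => /andP[ax xb].
  by rewrite (le_trans a0 ax) (le_trans (ltW xb) b1).
rewrite lebesgue_measure_itv /= lte_fin; case: ltgtP ab => // -> _.
by rewrite subrr.
Qed.

(* The most recent bit comes first. *)
Fixpoint bits (b : nat -> bool) (t : nat) : seq bool :=
  if t is t'.+1 then b t' :: bits b t' else [::].

Lemma size_bits b t : size (bits b t) = t.
Proof. by elim: t => //= t ->. Qed.

(** * Nested intervals with prescribed lengths *)

Section nested_intervals.
Context (R : realType) (p : seq bool -> R).
Hypothesis p_nil : p [::] = 1.
Hypothesis p_ge0 : forall s, 0 <= p s.
Hypothesis p_split : forall s, p s = p (false :: s) + p (true :: s).

(* The half-open interval attached to a binary string [s] has length [p s];
   it is the union of the intervals attached to the two extensions of [s]. *)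
Fixpoint left_end (s : seq bool) : R :=
  if s is b :: s' then left_end s' + (if b then p (false :: s') else 0) else 0.

Definition string_itv s : interval R := `[left_end s, left_end s + p s[.

(** Each new bit tells on which side of the cut point of the current interval [w] lies. *)
Fixpoint string_of (w : R) (t : nat) : seq bool :=
  if t is t'.+1 then
    let s := string_of w t' in (left_end (true :: s) <= w) :: s
  else [::].

(** Reals outside [0,1) borrow the digits of 0, so that statements about digits hold for every real
    and not just almost surely. *)
Definition clip (w : R) : R := if 0 <= w < 1 then w else 0.

Definition digit (w : R) (t : nat) : bool :=
  left_end (true :: string_of (clip w) t) <= clip w.

Lemma bits_digit w t : bits (digit w) t = string_of (clip w) t.
Proof. by elim: t => //= t ->. Qed.

Lemma string_itv_cons b s w : w \in string_itv (b :: s) =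
  (w \in string_itv s) && ((left_end (true :: s) <= w) == b).
Proof.
rewrite /string_itv !in_itv /= (p_split s) addrA.
have := p_ge0 (false :: s); have := p_ge0 (true :: s).
case: b => /=; rewrite ?addr0 => pT pF;
  case: (leP (left_end s + p (false :: s)) w) => h /=; rewrite ?andbF ?andbT//.
  by rewrite (le_trans _ h) ?lerDl.
by rewrite (lt_le_trans h) ?lerDl// andbT.
Qed.

Lemma string_ofP s w : 0 <= w < 1 ->
  (string_of w (size s) == s) = (w \in string_itv s).
Proof.
move=> w01; elim: s => [|b s IH] /=.
  by rewrite /string_itv in_itv /= p_nil add0r w01.
rewrite string_itv_cons -IH /= eqseq_cons andbC.
by case: eqP => [->|].
Qed.

Lemma string_itv_sub s : 0 <= left_end s /\ left_end s + p s <= 1.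
Proof.
elim: s => [|b s [l0 l1]] /=; first by rewrite p_nil add0r.
split; first by rewrite addr_ge0//; case: b.
apply: le_trans l1; rewrite -addrA lerD2l (p_split s).
by case: b; rewrite ?add0r ?lerDl.
Qed.

Lemma clip_itv w : 0 <= clip w < 1.
Proof. by rewrite /clip; case: ifPn => // _; rewrite lexx ltr01. Qed.

Lemma bits_digitE s : [set w | bits (digit w) (size s) = s] `&` `[0, 1[ =
  [set` string_itv s].
Proof.
have [l0 l1] := string_itv_sub s.
apply/seteqP; split => w /=.
  rewrite in_itv /= bits_digit => -[+ w01]; rewrite /clip w01 => /eqP.
  by rewrite string_ofP.
move=> ws; have w01 : 0 <= w < 1.
  move: ws; rewrite /string_itv /= in_itv /= => /andP[lw wl].
  by rewrite (le_trans l0 lw) (lt_le_trans wl l1).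
by rewrite in_itv /= w01 bits_digit /clip w01; split => //; apply/eqP;
  rewrite string_ofP.
Qed.

Lemma measurable_bits_digit t s : measurable [set w | bits (digit w) t = s].
Proof.
have [<-|ts] := eqVneq (size s) t; last first.
  rewrite (_ : mkset _ = set0)//; apply/seteqP; split => // w /= ws.
  by move: ts; rewrite -ws size_bits eqxx.
set A := [set w | _].
rewrite -(setIT A) -(setUv `[0, 1[%classic) setIUr.
apply: measurableU; first by rewrite bits_digitE; exact: measurable_itv.
(* Outside [0,1) the digits are constant, so that this part of the set is either the whole
   complement or empty. *)
have clipC w : (~` `[0, 1[%classic) w -> digit w = digit 0.
  move=> /= /negP; rewrite in_itv /= => /negbTE w01.
  by apply/funext => n; rewrite /digit {1 2}/clip w01 /clip lexx ltr01.
have mI : measurable (~` `[0 : R, 1[%classic).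
  by apply: measurableC; exact: measurable_itv.
have [A0|A0] := pselect (A 0).
  rewrite setIidr// => w /clipC; rewrite /A /= => ->; exact: A0.
rewrite (_ : _ `&` _ = set0)//; apply/seteqP; split => // w [/= Aw /clipC w0].
by apply: A0; rewrite /A /= -w0.
Qed.

Lemma prob_bits_digit s :
  uniform_prob (@ltr01 R) [set w | bits (digit w) (size s) = s] = (p s)%:E.
Proof.
have [l0 l1] := string_itv_sub s.
rewrite -(@probability_setI_full _ _ _ (uniform_prob (@ltr01 R)) _ `[0, 1[) //.
- rewrite bits_digitE; apply: etrans (uniform_prob_itvco l0 _ l1) _.
    by rewrite lerDl.
  by rewrite addrAC subrr add0r.
- exact: measurable_bits_digit.
- by apply: etrans (uniform_prob_itvco (lexx 0) ler01 (lexx 1)) _; rewrite subr0.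
Qed.

(** A half-open interval that contains a point has positive length. Thus no point ever produces a
    string of mass zero. *)
Lemma bits_digit_gt0 w t : 0 < p (bits (digit w) t).
Proof.
have := string_ofP (string_of (clip w) t) (clip_itv w).
have -> : size (string_of (clip w) t) = t by rewrite -bits_digit size_bits.
rewrite eqxx bits_digit => /esym; rewrite /string_itv in_itv /= => /andP[h1 h2].
by have := le_lt_trans h1 h2; rewrite ltrDl.
Qed.

End nested_intervals.

(** Tychonoff gives a cluster point [p] in a product of copies of [0,1]. Since [S] is countable,
    indices can be chosen recursively so that at stage k all coordinates with code below k are
    within 1/(k+1) of [p]; every coordinate is eventually among them. *)
Lemma pointwise_subsequence (R : realType) (S : countType) (a : nat -> S -> R) :
  (forall n s, 0 <= a n s <= 1) ->
  exists (phi : nat -> nat) (p : S -> R),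
    [/\ increasing_seq phi, (1 <= phi 0)%N &
        forall s, a (phi k) s @[k --> \oo] --> p s].
Proof.
move=> a01.
have cK : compact [set f : prod_topology (fun _ : S => R : topologicalType) |
    forall s, `[0, 1]%classic (f s)].
  apply: (@tychonoff S (fun _ => R : topologicalType) (fun=> `[0, 1]%classic)).
  by move=> s; exact: segment_compact.
have [|p [_ clp]] := cK (a @ \oo) _.
  by exists 0 => // n _ /= s; rewrite in_itv /= a01.
have step N k : exists n, (N < n)%N /\
    forall s, (pickle s < k)%N -> `|a n s - p s| < k.+1%:R^-1.
  have [||_ [[n /= Nn <-] Bn]] := clp (a @` [set n | (N < n)%N])
    [set f | forall s, (pickle s < k)%N -> `|f s - p s| < k.+1%:R^-1].
  - by exists N.+1 => // n /= Nn; exists n.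
  (* Finitely many coordinates are constrained, so this is a neighbourhood of [p] in the product
     topology; a number that codes nothing imposes no condition. *)
  - have near_i (i : 'I_k) : \forall f \near p,
        if unpickle i is Some s then `|f s - p s| < k.+1%:R^-1 else true.
      case: (unpickle i) => [s|]; last by apply: filterE.
      have /cvgrPdist_lt/(_ k.+1%:R^-1) : proj s @ p --> p s.
        exact: (@proj_continuous S (fun _ => R : topologicalType)).
      rewrite invr_gt0 ltr0n => /(_ isT); apply: filterS => f /=.
      by rewrite distrC.
    apply: (filterS _ (filter_forall _ near_i)) => f fi s sk.
    by have := fi (Ordinal sk); rewrite /= pickleK.
  by exists n.
have /choice[nxt nxtP] : forall Nk : nat * nat, exists n, (Nk.1 < n)%N /\
    forall s, (pickle s < Nk.2)%N -> `|a n s - p s| < Nk.2.+1%:R^-1.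
  by case=> N k; exact: step.
(* [nxt] exceeds its first argument: this makes [phi] increasing and [phi 0] positive. *)
pose phi := fix phi k := if k is k'.+1 then nxt (phi k', k) else nxt (0, 0)%N.
have phi_close k s : (pickle s < k)%N -> `|a (phi k) s - p s| < k.+1%:R^-1.
  by case: k => // k; exact: (nxtP (phi k, k.+1)).2.
exists phi, p; split => [|//|s].
- by apply/increasing_seqP => k; exact: (nxtP (phi k, k.+1)).1.
- exact: (nxtP (0, 0)%N).1.
- apply/cvgrPdist_lt => e e0.
  near=> k; rewrite distrC; apply: lt_trans (phi_close k s _) _.
    by near: k; exact: nbhs_infty_gt.
  by near: k; exact: (near_infty_natSinv_lt (PosNum e0)).
Unshelve. all: by end_near. Qed.

(** * Copulas and their measures *)

Lemma measurable_forall (disp : measure_display) (T : measurableType disp)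
    (I : finType) (A : I -> set T) :
  (forall i, measurable (A i)) -> measurable [set x | forall i, A i x].
Proof.
move=> mA; rewrite (_ : mkset _ = \bigcap_i A i); last first.
  by apply/seteqP; split => x /= h i //; exact: h.
exact: fin_bigcap_measurable.
Qed.

Lemma probability_forall_full (R : realType) (disp : measure_display)
    (T : measurableType disp) (P : probability T R) (I : finType)
    (A : I -> set T) :
  (forall i, measurable (A i)) -> (forall i, P (A i) = 1%E) ->
  P [set x | forall i, A i x] = 1%E.
Proof.
move=> mA PA.
suff h (s : seq I) : P (\big[setI/setT]_(i <- s) A i) = 1%E.
  rewrite -(h (enum I)); congr (P _); rewrite -bigcap_seq.
  apply/seteqP; split => x /= xA i; first by move=> _; exact: xA.
  by apply: xA; rewrite /= mem_enum.
elim: s => [|i s IH]; first by rewrite big_nil probability_setT.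
rewrite big_cons probability_setI_full//.
by apply: bigsetI_measurable => j _.
Qed.

Lemma measurable_box (R : realType) (d : nat) (A : 'I_d -> set R) :
  (forall k, measurable (A k)) ->
  measurable ([set x | forall k, A k ((x : 'rV[R]_d) ord0 k)] : set (borelRd R d)).
Proof.
move=> mA.
apply: (@measurable_forall _ (borelRd R d) _
  (fun k => [set x | A k ((x : 'rV[R]_d) ord0 k)])) => k.
by rewrite -[X in measurable X]setTI; exact: (measurable_coord k).
Qed.

Lemma measurable_unit_cube (R : realType) (d : nat) :
  measurable (unit_cube : set (borelRd R d)).
Proof.
have := @measurable_box R d (fun=> `[0, 1]%classic) (fun=> measurable_itv _).
by congr measurable; apply/seteqP; split => x /= h k; have := h k; rewrite in_itv.
Qed.

(** * Lower orthants, full-measure cubes and uniqueness of the copula measure *)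

Definition lower_box {R : realType} {d : nat} (u : 'rV[R]_d) : set (borelRd R d) :=
  [set x | forall k, (x : 'rV[R]_d) ord0 k <= u ord0 k].

Lemma lower_boxE (R : realType) (d : nat) (u : 'rV[R]_d) :
  lower_box u = [set x | forall k, `]-oo, u ord0 k]%classic ((x : 'rV[R]_d) ord0 k)].
Proof.
by apply/seteqP; split => x /= h k; have := h k; rewrite in_itv.
Qed.

Lemma measurable_lower_box (R : realType) (d : nat) (u : 'rV[R]_d) :
  measurable (lower_box u).
Proof.
rewrite lower_boxE; apply: (@measurable_box R d (fun k => `]-oo, u ord0 k]%classic)).
by move=> k; exact: measurable_itv.
Qed.

(** It suffices that the coordinates are measurable for the sigma-algebra generated by the orthants,
    since then so is the identity into the Borel space. *)
Lemma sigma_lower_box (R : realType) (d : nat) (E : set (borelRd R d)) :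
  measurable E -> <<s range (@lower_box R d) >> E.
Proof.
pose G : set (set 'rV[R]_d) := range (@lower_box R d).
have mcoord (k : 'I_d) : measurable_fun setT
    (fun x : g_sigma_algebraType G => (x : 'rV[R]_d) ord0 k).
  apply: (measurability (@RGenOInfty.G R)); first exact: RGenOInfty.measurableE.
  move=> _ [_ [c ->] <-]; rewrite setTI.
  (* The half-space where coordinate [k] is at most [c] is the increasing union of the orthants with
     bound [c] in direction [k] and bound n in the others. *)
  rewrite (_ : _ @^-1` _ = ~` \bigcup_n
      lower_box (\row_j (if j == k then c else n%:R))).
    apply: measurableC; apply: bigcupT_measurable => n.
    by apply: sub_sigma_algebra; exists (\row_j (if j == k then c else n%:R)).
  apply/seteqP; split => x /=; rewrite in_itv /= andbT.
    by move=> cx [n _ /(_ k)]; rewrite mxE eqxx leNgt cx.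
  apply: contra_notT; rewrite -leNgt => xc.
  exists (Num.truncn (\sum_j `|(x : 'rV[R]_d) ord0 j|)).+1 => // j.
  rewrite mxE; case: eqP => [->//|_].
  apply: le_trans (ltW (truncnS_gt _)); rewrite (bigD1 j)//=.
  by apply: le_trans (ler_norm _) _; rewrite lerDl sumr_ge0.
move=> mE.
have := @measurable_fun_borelRd R d _ (g_sigma_algebraType G) id mcoord measurableT.
by move=> /(_ _ mE); rewrite setTI.
Qed.

Definition uniform_marginals (R : realType) (d : nat)
    (mu : probability (borelRd R d) R) : Prop :=
  forall k (A : set R), measurable A ->
    mu [set x | A ((x : 'rV[R]_d) ord0 k)] = uniform_prob (@ltr01 R) A.

Section copula_measure_facts.
Context (R : realType) (d : nat).
Implicit Type mu : probability (borelRd R d) R.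

Lemma uniform_marginals_box mu (A : set R) : uniform_marginals mu ->
  measurable A -> uniform_prob (@ltr01 R) A = 1%E ->
  mu [set x | forall k, A ((x : 'rV[R]_d) ord0 k)] = 1%E.
Proof.
move=> muC mA A1.
apply: (@probability_forall_full _ _ (borelRd R d) mu _
  (fun k => [set x | A ((x : 'rV[R]_d) ord0 k)])) => k.
  by rewrite -[X in measurable X]setTI; exact: (measurable_coord k).
by rewrite muC.
Qed.

Lemma uniform_marginals_cube mu : uniform_marginals mu -> mu unit_cube = 1%E.
Proof.
move=> muC; have := @uniform_marginals_box mu `[0, 1]%classic muC.
apply => //; rewrite uniform_probE// setIid lebesgue_measure_itv/= lte_fin ltr01.
by rewrite sube0.
Qed.

Definition half_open_cube : set (borelRd R d) :=
  [set x | forall k, 0 <= (x : 'rV[R]_d) ord0 k < 1].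

Lemma half_open_cubeE : half_open_cube =
  [set x | forall k, `[0, 1[%classic ((x : 'rV[R]_d) ord0 k)].
Proof.
by apply/seteqP; split => x /= h k; have := h k; rewrite in_itv.
Qed.

Lemma measurable_half_open_cube : measurable half_open_cube.
Proof.
rewrite half_open_cubeE; apply: (@measurable_box R d (fun=> `[0, 1[%classic)).
by move=> k; exact: measurable_itv.
Qed.

Lemma half_open_cube_sub : half_open_cube `<=` unit_cube.
Proof. by move=> x h k; have /andP[-> /ltW] := h k. Qed.

Lemma uniform_marginals_half_open_cube mu : uniform_marginals mu ->
  mu half_open_cube = 1%E.
Proof.
move=> muC; rewrite half_open_cubeE; apply: uniform_marginals_box => //.
by rewrite uniform_prob_itvco// subr0.
Qed.

(** Lower orthants are stable under intersection, generate the Borel sets and exhaust the space, so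
    agreement on them is enough. *)
Lemma copula_measure_unique (C : 'rV[R]_d -> R) mu mu' (E : set (borelRd R d)) :
  is_copula_measure C mu -> is_copula_measure C mu' -> measurable E ->
  mu E = mu' E.
Proof.
move=> muC muC' mE.
(* Within the cube a negative bound leaves nothing and a bound above 1 acts as 1, so the values of
   [C] on the cube fix the mass of every orthant. *)
have lowerE (u : 'rV[R]_d) nu : is_copula_measure C nu -> nu (lower_box u) =
    if [forall k, 0 <= u ord0 k] then (C (\row_k Num.min (u ord0 k) 1))%:E else 0%E.
  move=> nuC; rewrite -(@probability_setI_full _ _ _ nu _ unit_cube)//; last 3 first.
  - exact: measurable_lower_box.
  - exact: measurable_unit_cube.
  - exact: uniform_marginals_cube nuC.1.
  case: ifPn => [/forallP u0|/forallPn[k]]; last first.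
    rewrite -ltNge => uk; rewrite [X in nu X](_ : _ = set0) ?measure0//.
    apply/seteqP; split => // x [/(_ k) xu /(_ k)/andP[x0 _]].
    by have := lt_le_trans (le_lt_trans xu uk) x0; rewrite ltxx.
  rewrite -(nuC.2 _ _); last first.
    by move=> k; rewrite mxE le_min u0 ler01 ge_min lexx orbT.
  congr (nu _); apply/seteqP; split => x /=.
    by move=> [xu x01] k; rewrite mxE le_min xu; exact: x01.
  move=> h; split => k; have := h k; rewrite mxE le_min => /and3P[] //.
  by move=> -> _ ->.
apply: (@g_sigma_algebra_measure_unique _ _ (borelRd R d) (range (@lower_box R d))
  _ (fun n => lower_box (const_mx n%:R))).
- by move=> _ [u _ <-]; exact: measurable_lower_box.
- by move=> n; exists (const_mx n%:R).
- apply/seteqP; split => // x _.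
  exists (Num.truncn (\sum_j `|(x : 'rV[R]_d) ord0 j|)).+1 => // j.
  rewrite mxE; apply: le_trans (ltW (truncnS_gt _)); rewrite (bigD1 j)//=.
  by apply: le_trans (ler_norm _) _; rewrite lerDl sumr_ge0.
- move=> _ _ [u _ <-] [v _ <-].
  exists (\row_k Num.min (u ord0 k) (v ord0 k)) => //.
  apply/seteqP; split => x /=.
    by move=> h; split => k; have := h k; rewrite mxE le_min => /andP[].
  by move=> [xu xv] k; rewrite mxE le_min xu xv.
- by move=> _ [u _ <-]; apply: (etrans (lowerE u mu muC)); exact/esym/lowerE.
- move=> n; apply: le_lt_trans (ltry 1).
  by apply: probability_le1; exact: measurable_lower_box.
- exact: sigma_lower_box.
Qed.

End copula_measure_facts.

(** * Passing between copulas and measures with uniform marginals *)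

Section copula_measures.
Context (R : realType) (d : nat).

(** The lower bound 0 in [is_copula_measure] removes no mass, because uniform marginals concentrate
    [mu] on the cube. *)
Lemma is_copula_measure_lower_box (mu : probability (borelRd R d) R)
    (C : 'rV[R]_d -> R) :
  uniform_marginals mu ->
  (forall u, unit_cube u -> (C u)%:E = mu (lower_box u)) ->
  is_copula_measure C mu.
Proof.
move=> unif CE; split; first exact: unif.
move=> u u01; rewrite CE// -[RHS](@probability_setI_full _ _ _ mu _ unit_cube) //.
- congr (mu _); apply/seteqP; split => x /=.
    move=> h; split => k; have /andP[xk0 xku] := h k; rewrite ?xk0//=.
    by apply: le_trans xku _; have /andP[] := u01 k.
  by move=> [xu x01] k; rewrite xu andbT; have /andP[] := x01 k.
- exact: measurable_lower_box.
- exact: measurable_unit_cube.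
- exact: uniform_marginals_cube.
Qed.

(** The law of the random vector behind [C] is a witness for the choice made by [get]. *)
Lemma copula_measureP (C : 'rV[R]_d -> R) :
  is_copula C -> is_copula_measure C (copula_measure C).
Proof.
move=> [disp [T [P [U [unif CE]]]]].
pose f w : borelRd R d := \row_k U k w.
have mf : measurable_fun setT f.
  apply: measurable_fun_borelRd => k.
  by rewrite (_ : (fun w => _) = U k)//; apply/funext => w; rewrite mxE.
pose X : {mfun T >-> borelRd R d} := mfun_Sub (mem_set mf).
pose mu : probability (borelRd R d) R := distribution P X.
apply: (@getPex _ [set mu | is_copula_measure C mu]); exists mu.
apply: is_copula_measure_lower_box => [k A mA|u u01].
  rewrite -(unif k)// /distribution /pushforward; congr (P _).
  by apply/seteqP; split => w /=; rewrite mxE.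
rewrite CE//; congr (P _).
by apply/seteqP; split => w /= h k; have := h k; rewrite mxE.
Qed.

(** The random vector is the identity: the coordinates are random variables on the probability space
    given by [mu] itself. *)
Lemma copula_of_uniform_marginals (mu : probability (borelRd R d) R) :
  uniform_marginals mu ->
  exists C : 'rV[R]_d -> R, is_copula C /\ is_copula_measure C mu.
Proof.
move=> unif; exists (fun u => fine (mu (lower_box u))).
have CE u : (fine (mu (lower_box u)))%:E = mu (lower_box u).
  by rewrite probabilityE_fine//; exact: measurable_lower_box.
split; last exact: is_copula_measure_lower_box.
exists _, (borelRd R d), mu, (fun k => mfun_Sub (mem_set (@measurable_coord R d k))).
by split => [k A mA|u u01]; [exact: unif|exact: CE].
Qed.

End copula_measures.

(** * Continuous functions on the cube *)

Lemma compact_unit_cube (R : realType) (d : nat) :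
  compact (unit_cube : set 'rV[R]_d).
Proof.
have := @rV_compact R d (fun=> `[0, 1]%classic) (fun=> @segment_compact R 0 1).
by congr compact; apply/seteqP; split => x /= h k; have := h k; rewrite in_itv.
Qed.

Section continuous_on_cube.
Context (R : realType) (d : nat) (h : 'rV[R]_d -> R).
Hypothesis h_cont : {within unit_cube, continuous h}.

Lemma unit_cube_unif_continuous (e : R) : 0 < e ->
  exists2 r : R, 0 < r & forall x y, unit_cube x -> unit_cube y ->
    (forall k, `|x ord0 k - y ord0 k| < r) -> `|h x - h y| < e.
Proof.
move=> e0.
have := @compact_unit_cube R d.
move=> /compact_near_coveringP/(_ R (0^'+)
  (fun r x => forall y, unit_cube x -> unit_cube y ->
    (forall k, `|x ord0 k - y ord0 k| < r) -> `|h x - h y| < e)).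
move=> /(_ _)[].
  move=> x x01.
  have /subspace_continuousP/(_ x x01)/cvgrPdist_lt/(_ (e / 2)) := h_cont.
  rewrite divr_gt0// => /(_ isT); rewrite near_withinE => /nbhs_ballP[r /= r0 hr].
  (* Half of [r] for moving the centre and half for the modulus keep both points within [r] of
     [x]. *)
  exists (ball x (r / 2), [set s | 0 < s < r / 2]).
    split; first by apply: nbhsx_ballx; rewrite divr_gt0.
    near=> s => /=; apply/andP; split; near: s; first exact: nbhs_right_gt.
    by apply: nbhs_right_lt; rewrite divr_gt0.
  move=> [x' s] /= [[_ xx'] /andP[s0 sr]] y x'01 y01 x'y.
  have hx' : `|h x - h x'| < e / 2.
    apply: hr => //; split => // i k; rewrite ord1; have := xx' ord0 k.
    by rewrite /ball /= => /lt_trans; apply; rewrite gtr_pMr// invf_lt1// ltr1n.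
  have hy : `|h x - h y| < e / 2.
    apply: hr => //; split => // i k; rewrite ord1; have := xx' ord0 k.
    rewrite /ball /= => xx'k.
    rewrite -(subrK (x' ord0 k) (x ord0 k)) -addrA (splitr r).
    apply: le_lt_trans (ler_normD _ _) _; apply: ltrD => //.
    exact: lt_trans (x'y k) sr.
  rewrite (_ : h x' - h y = (h x - h y) - (h x - h x')); last by lra.
  rewrite (splitr e); apply: le_lt_trans (ler_normB _ _) _; exact: ltrD.
move=> r /= r0 hr; exists (r / 2) => [|x y x01 y01 xy]; first by rewrite divr_gt0.
apply: (hr (r / 2)) => //=; last by rewrite divr_gt0.
by rewrite sub0r normrN gtr0_norm ?divr_gt0// gtr_pMr// invf_lt1// ltr1n.
Unshelve. all: by end_near. Qed.

Lemma unit_cube_bounded : exists M, forall x, unit_cube x -> `|h x| <= M.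
Proof.
have [M [_ hM]] := compact_bounded (continuous_compact h_cont (@compact_unit_cube R d)).
exists (M + 1) => x x01; apply: hM; first by rewrite ltrDl.
by exists x.
Qed.

(** Continuity within the cube makes the preimage of an open interval the trace of an open set on
    the cube. *)
Lemma unit_cube_measurable :
  measurable_fun (unit_cube : set (borelRd R d)) h.
Proof.
apply: (measurability (@RGenOpens.G R)); first exact: RGenOpens.measurableE.
move=> _ [_ [a [b ->]] <-].
have /continuousP/(_ `]a, b[%classic (interval_open _ _)) := h_cont.
move=> /(_ isT isT)/open_subspaceP[V oV VE].
rewrite setIC -VE; apply: measurableI; last exact: measurable_unit_cube.
exact: sub_sigma_algebra.
Qed.

Lemma unit_cube_integrable (mu : probability (borelRd R d) R) :
  mu.-integrable unit_cube (EFin \o h).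
Proof.
have [M hM] := unit_cube_bounded.
apply: (@bounded_integrable _ _ _ mu _ _ M) => //.
  exact: measurable_unit_cube.
exact: unit_cube_measurable.
Qed.

End continuous_on_cube.

(** * Weak compactness *)

Lemma bits_eqP (b b' : nat -> bool) t :
  bits b t = bits b' t <-> forall i, (i < t)%N -> b i = b' i.
Proof.
elim: t => [|t IH] /=; first by split.
split=> [[bt /IH h] i|h].
  by rewrite ltnS leq_eqVlt => /predU1P[->|/h].
by rewrite h// (IH.2 _)// => i it; apply: h; rewrite (ltn_trans it).
Qed.

Lemma measurable_bits (disp : measure_display) (T : measurableType disp)
    (b : T -> nat -> bool) :
  (forall i, measurable [set x | b x i]) ->
  forall t s, measurable [set x | bits (b x) t = s].
Proof.
move=> mb; elim=> [|t IH] [|c s] /=.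
- by rewrite (_ : mkset _ = setT)//; apply/seteqP.
- by rewrite (_ : mkset _ = set0)//; apply/seteqP; split.
- by rewrite (_ : mkset _ = set0)//; apply/seteqP; split.
- rewrite (_ : mkset _ = [set x | b x t = c] `&` [set x | bits (b x) t = s]).
    apply: measurableI => //; case: c; first exact: mb.
    rewrite (_ : mkset _ = ~` [set x | b x t]); first exact: measurableC.
    by apply/seteqP; split => x /=; [move=> ->|move/negP/negbTE].
  by apply/seteqP; split => x /= [] -> ->.
Qed.

Definition tbits (b : nat -> bool) (t : nat) : t.-tuple bool :=
  Tuple (introT eqP (size_bits b t)).

Lemma Rintegral_bits (R : realType) (disp : measure_display)
    (T : measurableType disp) (P : probability T R) (b : T -> nat -> bool)
    (g : seq bool -> R) (t : nat) :
  (forall s, measurable [set x | bits (b x) t = s]) ->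
  P.-integrable setT (EFin \o (fun x => g (bits (b x) t))) /\
  \int[P]_x g (bits (b x) t) =
    \sum_(s : t.-tuple bool) g s * fine (P [set x | bits (b x) t = s]).
Proof.
move=> mb.
have setE (s : t.-tuple bool) :
    [set x | tbits (b x) t = s] = [set x | bits (b x) t = s].
  apply/seteqP; split => x /= [] h; last exact: val_inj.
  by rewrite -h.
have [|i1 i2] := @Rintegral_simple R _ _ P _ (fun x => tbits (b x) t) (g \o val).
  by move=> s; rewrite setE.
split; first exact: i1.
by rewrite [LHS]i2; apply: eq_bigr => s _; rewrite setE.
Qed.

(** * Coding points by rational thresholds *)

Section grid_bits.
Context (R : realType) (d : nat).

Definition vbit (x : 'rV[R]_d) (i : nat) : bool :=
  if unpickle i is Some kq then ratr (kq : 'I_d * rat).2 <= x ord0 kq.1 else false.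

Lemma measurable_vbit i : measurable ([set x | vbit x i] : set (borelRd R d)).
Proof.
rewrite /vbit; case: (unpickle i) => [[k q]|] /=; last first.
  by rewrite (_ : mkset _ = set0)//; apply/seteqP; split => x.
have := @measurable_coord R d k measurableT _ (measurable_itv `[(ratr q : R), +oo[).
rewrite setTI; congr measurable.
by apply/seteqP; split => x /=; rewrite in_itv /= andbT.
Qed.

(** Take 1/N < [e] and let [t] exceed the codes of the finitely many thresholds m/N with m <= N.
    Points with the same bits reach the same thresholds in every coordinate. *)
Lemma vbit_resolution (e : R) : 0 < e -> exists t, forall x y : 'rV[R]_d,
  unit_cube x -> unit_cube y -> bits (vbit x) t = bits (vbit y) t ->
  forall k, `|x ord0 k - y ord0 k| < e.
Proof.
move=> e0; pose N := (Num.truncn e^-1).+1.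
have Ne : (N%:R^-1 : R) < e by rewrite invf_plt ?posrE// truncnS_gt.
pose code (km : 'I_d * 'I_N.+1) := pickle (km.1, km.2%:R / N%:R : rat).
exists (\max_km code km).+1 => x y x01 y01 /bits_eqP xy k.
suff half (u v : 'rV[R]_d) : unit_cube u -> unit_cube v ->
    (forall i, (i < (\max_km code km).+1)%N -> vbit u i = vbit v i) ->
    u ord0 k < v ord0 k + N%:R^-1.
  have h1 := half _ _ x01 y01 xy.
  have h2 := half _ _ y01 x01 (fun i it => esym (xy i it)).
  by rewrite ltr_norml; apply/andP; split; lra.
move=> u01 v01 uv; have /andP[u0 u1] := u01 k.
(* The largest threshold m/N reached by [u] is also reached by [v], so N u < m + 1 <= N v + 1 in
   coordinate [k]. *)
have Nu0 : 0 <= N%:R * u ord0 k by rewrite mulr_ge0.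
have /andP[mu um] := truncn_itv Nu0.
set m := Num.truncn _ in mu um.
have mN : (m < N.+1)%N.
  rewrite ltnS -(ler_nat R); apply: le_trans mu _.
  by rewrite ler_piMr.
have := uv (code (k, Ordinal mN)); rewrite ltnS leq_bigmax// => /(_ isT).
have vbitE z : vbit z (code (k, Ordinal mN)) = (m%:R / N%:R <= z ord0 k).
  have -> : m%:R / N%:R = ratr (m%:R / N%:R) :> R by rewrite fmorph_div !rmorph_nat.
  by rewrite /vbit /code pickleK.
rewrite !vbitE.
rewrite ler_pdivrMr ?ltr0n// mulrC mu => /esym vm.
rewrite -(ltr_pM2l (x := N%:R)) ?ltr0n// mulrDr mulfV ?pnatr_eq0//.
apply: lt_le_trans um _; rewrite -natr1 lerD2r.
by rewrite mulrC -ler_pdivrMr ?ltr0n.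
Qed.

End grid_bits.

(** [h] is controlled only on the cube, so the change of variables is applied to its extension by
    zero, which has the same composite with [X]. *)
Lemma Rintegral_distribution_cube (R : realType) (d : nat)
    (disp : measure_display) (T : measurableType disp) (P : probability T R)
    (X : {mfun T >-> borelRd R d}) (h : 'rV[R]_d -> R) :
  (forall w, unit_cube (X w : 'rV[R]_d)) -> {within unit_cube, continuous h} ->
  P.-integrable setT (EFin \o (h \o X)) /\
  \int[distribution P X]_(x in unit_cube) h x = \int[P]_w h (X w).
Proof.
move=> X01 h_cont; have mcube := @measurable_unit_cube R d.
have mh := unit_cube_measurable h_cont.
have hX_int : P.-integrable setT (EFin \o (h \o X)).
  have [M hM] := unit_cube_bounded h_cont.
  apply: (@bounded_integrable _ _ _ P _ _ M) => //; last by move=> w _; exact: hM.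
  apply: (@measurable_comp _ _ _ _ (borelRd R d) _ unit_cube) => //.
  by move=> _ [w _ <-].
split=> //; rewrite /Rintegral; congr fine; rewrite integral_mkcond.
have patchX : ((EFin \o h) \_ unit_cube) \o X = EFin \o (h \o X).
  by apply/funext => w; rewrite /= patchE mem_set.
rewrite integral_pushforward ?patchX//.
exact/(measurable_restrictT _ mcube)/measurable_EFinP.
Qed.

(** * Weak sequential compactness of probability measures on the cube *)

Section prokhorov.
Context (R : realType) (d : nat) (mu : nat -> probability (borelRd R d) R).
Hypothesis mu_cube : forall n, mu n unit_cube = 1%E.

Let cell s : set (borelRd R d) := [set x | bits (vbit x) (size s) = s].

Let mcell s : measurable (cell s).
Proof. by apply: measurable_bits => i; exact: measurable_vbit. Qed.

Let mass n s : R := fine (mu n (cell s)).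

Let mass_nil n : mass n [::] = 1.
Proof.
rewrite /mass (_ : cell _ = setT) ?probability_setT//.
by apply/seteqP; split.
Qed.

Let mass_itv n s : 0 <= mass n s <= 1.
Proof.
rewrite fine_ge0//= -lee_fin probabilityE_fine//.
exact: probability_le1.
Qed.

Let mass_split n s : mass n s = mass n (false :: s) + mass n (true :: s).
Proof.
apply: EFin_inj; rewrite EFinD !probabilityE_fine//.
have mI b : cell (b :: s) = cell s `&` [set x | vbit x (size s) = b].
  by apply/seteqP; split => x; rewrite /cell /= => -[h1 h2]; rewrite ?h1 ?h2.
have mb : measurable ([set x | vbit x (size s) = true] : set (borelRd R d)).
  exact: measurable_vbit.
have mbC : [set x : 'rV[R]_d | vbit x (size s) = false] =
    ~` [set x | vbit x (size s) = true].
  apply/seteqP; split => x /=; first by move=> ->.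
  by move/negP/negbTE.
rewrite !mI mbC -setDE; exact: (measureDI (mu n)).
Qed.

Let rep_ex s : exists x : 'rV[R]_d,
  (exists2 y, unit_cube y & cell s y) -> unit_cube x /\ cell s x.
Proof.
have [[y y1 y2]|no] := pselect (exists2 y, unit_cube y & cell s y).
  by exists y.
by exists 0 => /no.
Qed.

(** The value is arbitrary when the cell misses the cube; such a cell has mass zero under every
    [mu n]. *)
Let rep s : 'rV[R]_d := projT1 (cid (rep_ex s)).

Let repP s x : unit_cube x -> cell s x -> unit_cube (rep s) /\ cell s (rep s).
Proof.
by move=> x01 sx; rewrite /rep; case: cid => /= y; apply; exists x.
Qed.

Lemma prokhorov_cube : exists (phi : nat -> nat)
    (nu : probability (borelRd R d) R),
  [/\ increasing_seq phi, (1 <= phi 0)%N, nu unit_cube = 1%E &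
   forall h : 'rV[R]_d -> R, {within unit_cube, continuous h} ->
     \int[mu (phi k)]_(x in unit_cube) h x @[k --> \oo] -->
     \int[nu]_(x in unit_cube) h x].
Proof.
have [phi [p [phi_inc phi0 phi_cvg]]] := pointwise_subsequence mass_itv.
have p_nil : p [::] = 1.
  rewrite -(cvg_lim _ (phi_cvg [::]))//.
  by under eq_fun do rewrite mass_nil; rewrite lim_cst.
have p_ge0 s : 0 <= p s.
  rewrite -(cvg_lim _ (phi_cvg s))//; apply: limr_ge; first exact: cvgP (phi_cvg s).
  by apply: nearW => k; have /andP[] := mass_itv (phi k) s.
have p_split s : p s = p (false :: s) + p (true :: s).
  rewrite -(cvg_lim _ (phi_cvg s))//; apply: cvg_lim => //.
  under eq_fun do rewrite mass_split.
  exact: cvgD (phi_cvg _) (phi_cvg _).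
pose b := digit p.
have mb := @measurable_bits_digit R p p_nil p_ge0 p_split.
(* A string of positive limit mass has positive mass for some [mu n], hence it is
   the code of an actual point of the cube. *)
have rep_b t w : unit_cube (rep (bits (b w) t)) /\
    bits (vbit (rep (bits (b w) t))) t = bits (b w) t.
  have := @bits_digit_gt0 R p p_nil p_ge0 p_split w t.
  rewrite -/b; set s := bits (b w) t => ps.
  have ss : size s = t by rewrite size_bits.
  suff [x x01 sx] : exists2 x, unit_cube x & cell s x.
    by have := repP x01 sx; rewrite /cell /= ss.
  apply: contrapT => no; move: ps; rewrite ltNge => /negP; apply.
  rewrite -(cvg_lim _ (phi_cvg s))//; apply: limr_le; first exact: cvgP (phi_cvg s).
  apply: nearW => k; rewrite /mass -(@probability_setI_full _ _ (borelRd R d) _ _ unit_cube)//.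
    rewrite (_ : _ `&` _ = set0) ?measure0//.
    by apply/seteqP; split => // x [sx x01]; apply: no; exists x.
  exact: measurable_unit_cube.
(* Approximations of X(w) by representatives of the nested cells. They share their first bits, so
   the resolution of the code makes them Cauchy in every coordinate. *)
pose Y t w := rep (bits (b w) t).
have Y_bits t w i : (i < t)%N -> vbit (Y t w) i = b w i.
  by move: (rep_b t w).2 i => /bits_eqP h i /h.
have Y_close e : 0 < e -> exists T, forall t t' w k, (T <= t)%N -> (T <= t')%N ->
    `|Y t w ord0 k - Y t' w ord0 k| < e.
  move=> e0; have [T hT] := @vbit_resolution R d e e0.
  exists T => t t' w k Tt Tt'; apply: hT (rep_b _ _).1 (rep_b _ _).1 _ _.
  by apply/bits_eqP => i iT; rewrite !Y_bits//; exact: leq_trans iT _.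
have Y_cvg w k : cvgn (fun t => Y t w ord0 k).
  apply: cauchy_cvg; apply/cauchy_ballP => e e0; have [T hT] := Y_close e e0.
  pose A := (fun t => Y t w ord0 k) @` [set t | (T <= t)%N].
  have YA : \forall t \near \oo, A (Y t w ord0 k) by exists T => // t Tt; exists t.
  exists (A, A) => // -[_ _] /= [[t Tt <-] [t' Tt' <-]]; exact: hT.
pose X0 w : borelRd R d := \row_k limn (fun t => Y t w ord0 k).
(* The limit may land on a threshold and have other bits than the approximations, so only its
   distance to them is used. *)
have X0_close e : 0 < e -> exists T, forall t w k, (T <= t)%N ->
    `|(X0 w : 'rV[R]_d) ord0 k - Y t w ord0 k| <= e.
  move=> e0; have [T hT] := Y_close e e0; exists T => t w k Tt.
  rewrite /X0 mxE.
  have cvgYY : `|Y t' w ord0 k - Y t w ord0 k| @[t' --> \oo] -->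
      `|limn (fun t => Y t w ord0 k) - Y t w ord0 k|.
    by apply: cvg_norm; apply: cvgB; [exact: Y_cvg|exact: cvg_cst].
  rewrite -(cvg_lim _ cvgYY)//; apply: limr_le; first exact: cvgP cvgYY.
  by near=> t'; apply/ltW/hT => //; near: t'; exact: nbhs_infty_ge.
have mX0 : measurable_fun setT X0.
  apply: measurable_fun_borelRd => k.
  apply: (@measurable_realfun.measurable_fun_cvg _ _ _ setT (fun t w => Y t w ord0 k)).
    move=> t; have [+ _] := @Rintegral_bits R _ _ (uniform_prob (@ltr01 R)) b
      (fun s => rep s ord0 k) t (mb t).
    by move/integrableP => [/measurable_EFinP].
  by move=> w _; rewrite /X0 mxE; exact: Y_cvg.
pose X := @mfun_Sub _ _ (measurableTypeR R) (borelRd R d) _ (mem_set mX0).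
have X01 w : unit_cube (X w : 'rV[R]_d).
  move=> k; rewrite -[X w]/(X0 w) /X0 mxE; apply/andP; split.
    apply: limr_ge; first exact: Y_cvg.
    by apply: nearW => t; have /andP[] := (rep_b t w).1 k.
  apply: limr_le; first exact: Y_cvg.
  by apply: nearW => t; have /andP[] := (rep_b t w).1 k.
pose P : probability (measurableTypeR R) R := uniform_prob (@ltr01 R).
exists phi, (distribution P X); split => // [|h h_cont].
  rewrite -(@probability_setT _ _ _ P); congr (P _).
  by apply/seteqP; split => // w _; exact: X01.
have [hX_int ->] := Rintegral_distribution_cube P X01 h_cont.
apply/cvgrPdist_le => e e0.
(* One third each for replacing X(w) by [Y t w], for replacing a point by the representative of its
   cell under [mu n], and for the convergence of finitely many masses. *)
have e3 : 0 < e / 3 by rewrite divr_gt0.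
have [r r0 hr] := unit_cube_unif_continuous h_cont e3.
have r2 : 0 < r / 2 by rewrite divr_gt0.
have [t1 ht1] := vbit_resolution d r0.
have [t2 ht2] := X0_close _ r2.
(* [t1] bits put a point of the cube within [r] of its representative; from [t2] on, [Y t] is within
   [r / 2] of [X], the half turning a weak bound into a strict one. *)
pose t := maxn t1 t2.
(* One finite sum serves both sides: with [p] it is an integral under [P], with [mass n] an integral
   under [mu n]. *)
pose approx (q : seq bool -> R) := \sum_(s : t.-tuple bool) h (rep s) * q s.
have approx_P : `|\int[P]_w h (X w) - approx p| <= e / 3.
  have [i1 i2] := @Rintegral_bits R _ _ P b (h \o rep) t (mb t).
  rewrite (_ : approx p = \int[P]_w h (Y t w)); last first.
    rewrite [RHS]i2; apply: eq_bigr => s _; congr (_ * _).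
    have := @prob_bits_digit R p p_nil p_ge0 p_split s.
    by rewrite size_tuple => /(congr1 fine).
  apply: (@Rintegral_close _ _ _ P _ setT) => //; first exact: probability_setT.
  move=> w _; apply/ltW/hr => // [|k]; first exact: (rep_b t w).1.
  apply: le_lt_trans (ht2 t w k (leq_maxr _ _)) _.
  by rewrite gtr_pMr// invf_lt1// ltr1n.
have approx_mu n : `|\int[mu n]_(x in unit_cube) h x - approx (mass n)| <= e / 3.
  have [i1 i2] := @Rintegral_bits R _ _ (mu n) (@vbit R d) (h \o rep) t
    (measurable_bits (fun i => @measurable_vbit R d i) t).
  have mcube := @measurable_unit_cube R d.
  have -> : approx (mass n) =
      \int[mu n]_(x in unit_cube) h (rep (bits (vbit x) t)).
    rewrite -[RHS](@Rintegral_full _ _ _ (mu n) setT)//.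
    rewrite [RHS]i2; apply: eq_bigr => s _; congr (_ * _).
    by rewrite /mass /cell size_tuple.
  apply: (@Rintegral_close _ _ _ (mu n) _ unit_cube) => //.
  - exact: unit_cube_integrable.
  - by apply: integrableS i1.
  move=> x x01; have [|r01 rx] := @repP (bits (vbit x) t) x x01.
    by rewrite /cell /= size_bits.
  apply/ltW/hr => // k; apply: ht1 => //.
  move: rx; rewrite /cell /= size_bits => /bits_eqP rx.
  by apply/bits_eqP => i it; rewrite rx// (leq_trans it)// leq_maxl.
have approx_cvg : approx (mass (phi k)) @[k --> \oo] --> approx p.
  apply: cvg_big => //; first exact: add_continuous.
  by move=> s _; apply: cvgM; [exact: cvg_cst|exact: phi_cvg].
near=> k.
have : `|approx p - approx (mass (phi k))| <= e / 3.
  by near: k; move/cvgrPdist_le : approx_cvg; exact.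
have := approx_mu (phi k).
move: approx_P.
set A := \int[P]_w _; set B := \int[_]_(x in _) _; set A' := approx p.
set B' := approx _ => h1 h2 h3.
rewrite (_ : A - B = (A - A') + (A' - B') - (B - B')); last by lra.
rewrite (_ : e = e / 3 + e / 3 + e / 3); last by lra.
apply: le_trans (ler_normB _ _) _; apply: lerD => //.
by apply: le_trans (ler_normD _ _) _; exact: lerD.
Unshelve. all: by end_near. Qed.

End prokhorov.

(** * Uniform marginals pass to weak limits *)

Lemma Rintegral_indic_full (R : realType) (disp : measure_display)
    (T : measurableType disp) (P : probability T R) (A D : set T) :
  measurable A -> measurable D -> P D = 1%E ->
  \int[P]_(x in D) \1_A x = fine (P A).
Proof.
move=> mA mD PD; rewrite /Rintegral integral_indic//.
by congr fine; exact: probability_setI_full.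
Qed.

(** The added interval ]c, c + e] has length [e]. This continuity of the uniform law closes the
    squeeze between ramps. *)
Lemma uniform_prob_itvNycD (R : realType) (c e : R) : 0 < e ->
  fine (uniform_prob (@ltr01 R) `]-oo, c + e]) <=
  fine (uniform_prob (@ltr01 R) `]-oo, c]) + e.
Proof.
move=> e0.
rewrite -lee_fin EFinD !probabilityE_fine//.
have -> : `]-oo, c + e]%classic = `]-oo, c]%classic `|` `]c, c + e]%classic.
  apply/seteqP; split => x /=; rewrite !in_itv /=.
    by move=> ->; rewrite andbT; case: (leP x c) => ?; [left|right].
  by case=> [xc|/andP[]//]; apply: le_trans xc _; rewrite lerDl ltW.
have le_e : (uniform_prob (@ltr01 R) `]c, (c + e)%R]%classic <= e%:E)%E.
  rewrite uniform_probE//.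
  apply: (@le_trans _ _ (lebesgue_measure (`]c, (c + e)%R]%classic : set R))).
    by apply: le_measure; rewrite ?inE//; exact: measurableI.
  rewrite lebesgue_measure_itv /= lte_fin ltrDl e0 -EFinD lee_fin.
  by rewrite addrAC subrr add0r.
by apply: le_trans (measureU2 _ _ _) _ => //; apply: leeD => //; exact: le_e.
Qed.

Section marginals.
Context (R : realType) (d : nat) (k : 'I_d).

Let lower c : set (borelRd R d) :=
  [set x | `]-oo, c]%classic ((x : 'rV[R]_d) ord0 k)].

Let mlower c : measurable (lower c).
Proof. by rewrite -[X in measurable X]setTI; exact: (measurable_coord k). Qed.

(** For [e] positive, a continuous function of coordinate [k] that is 1 up to [c], 0 from [c + e] on
    and affine between. *)
Let ramp c e (x : 'rV[R]_d) : R := Num.max 0 (Num.min 1 ((c + e - x ord0 k) / e)).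

Let ramp_continuous c e : {within unit_cube, continuous (ramp c e)}.
Proof.
apply: continuous_subspaceT => x.
pose g (y : 'rV[R]_d) : R^o := (c + e - y ord0 k) / e.
have gx : {for x, continuous g}.
  exact: (cvgM (cvgB (cvg_cst (c + e)) (@coord_continuous R 1 d ord0 k x))
               (cvg_cst e^-1)).
have g1x := @continuous_min R _ (cst 1) g x (@cst_continuous _ _ _ x) gx.
exact: (@continuous_max R _ (cst 0) _ x (@cst_continuous _ _ _ x) g1x).
Qed.

Let ramp_sandwich (mu : probability (borelRd R d) R) c e :
  0 < e -> mu unit_cube = 1%E ->
  fine (mu (lower c)) <= \int[mu]_(x in unit_cube) ramp c e x <=
  fine (mu (lower (c + e))).
Proof.
move=> e0 mu1; have mcube := @measurable_unit_cube R d.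
have int1 c' : mu.-integrable unit_cube (EFin \o \1_(lower c')).
  by apply: (integrableS measurableT mcube) => //; exact: integrable_indic.
rewrite -!(@Rintegral_indic_full _ _ _ mu _ unit_cube)//.
apply/andP; split; apply: le_Rintegral => //.
- exact: unit_cube_integrable.
- move=> x _; rewrite /ramp indicE le_max.
  have [|_] := boolP (x \in _); last by rewrite lexx.
  rewrite inE /lower /= in_itv /= => xc; apply/orP; right.
  rewrite le_min lexx /= ler_pdivlMr// mul1r; lra.
- exact: unit_cube_integrable.
- move=> x _; rewrite /ramp indicE ge_max ler0n /= ge_min.
  have [|] := boolP (x \in _); first by rewrite lexx.
  rewrite notin_setE /lower /= in_itv /= => /negP; rewrite -ltNge => xc.
  by rewrite ler_pdivrMr// mul0r subr_le0 (ltW xc) orbT.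
Qed.

Lemma uniform_marginal_limit (mu : nat -> probability (borelRd R d) R)
    (nu : probability (borelRd R d) R) (A : set R) :
  (forall n, uniform_marginals (mu n)) -> nu unit_cube = 1%E ->
  (forall h : 'rV[R]_d -> R, {within unit_cube, continuous h} ->
     \int[mu n]_(x in unit_cube) h x @[n --> \oo] -->
     \int[nu]_(x in unit_cube) h x) ->
  measurable A ->
  nu [set x | A ((x : 'rV[R]_d) ord0 k)] = uniform_prob (@ltr01 R) A.
Proof.
move=> unif nu1 mu_nu mA.
pose u c := fine (uniform_prob (@ltr01 R) `]-oo, c]).
have mu_lower n c : fine (mu n (lower c)) = u c by rewrite /lower unif.
have sandwich n c e : 0 < e ->
    u c <= \int[mu n]_(x in unit_cube) ramp c e x <= u (c + e).
  move=> e0; rewrite -!(mu_lower n); apply: ramp_sandwich => //.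
  exact: uniform_marginals_cube.
have u_ramp c e : 0 < e ->
    u c <= \int[nu]_(x in unit_cube) ramp c e x <= u (c + e).
  move=> e0; have h := mu_nu _ (@ramp_continuous c e).
  rewrite -(cvg_lim _ h)//; apply/andP; split.
    apply: limr_ge; first exact: cvgP h.
    by apply: nearW => n; have /andP[] := sandwich n c e e0.
  apply: limr_le; first exact: cvgP h.
  by apply: nearW => n; have /andP[] := sandwich n c e e0.
(* The ramp from [c] to [c + e] bounds from above, the one from [c - e] to [c] from below; each
   costs at most [e]. *)
have nu_u c : nu (lower c) = uniform_prob (@ltr01 R) `]-oo, c].
  rewrite -probabilityE_fine// -[RHS]probabilityE_fine//; congr (_ %:E).
  rewrite -/(u c); apply/eqP; rewrite eq_le; apply/andP; split;
    apply/ler_addgt0Pr => e e0.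
    have /andP[h1 _] := ramp_sandwich c e0 nu1.
    have /andP[_ h2] := u_ramp c e e0.
    exact: le_trans (le_trans h1 h2) (uniform_prob_itvNycD c e0).
  have /andP[_ h1] := ramp_sandwich (c - e) e0 nu1.
  have /andP[h2 _] := u_ramp (c - e) e e0.
  have := uniform_prob_itvNycD (c - e) e0; rewrite subrK in h1 *.
  by move=> h3; apply: le_trans h3 _; rewrite lerD2r; exact: le_trans h2 h1.
have mXk : @measurable_fun _ _ (borelRd R d) (measurableTypeR R) setT
    (fun x => (x : 'rV[R]_d) ord0 k) by exact: measurable_coord.
pose Xk : {mfun borelRd R d >-> measurableTypeR R} :=
  @mfun_Sub _ _ (borelRd R d) (measurableTypeR R) _ (mem_set mXk).
pose m1 : {measure set (measurableTypeR R) -> \bar R} := distribution nu Xk.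
pose m2 : {measure set (measurableTypeR R) -> \bar R} := uniform_prob (@ltr01 R).
suff : m1 A = m2 A by [].
apply: (@measure_unique _ R (measurableTypeR R) (@RGenOInfty.G R) (fun n => `](- n%:R), +oo[%classic)) => //.
- exact: RGenOInfty.measurableE.
- move=> _ _ [a ->] [b ->]; exists (Num.max a b).
  apply/seteqP; split => x /=; rewrite !in_itv /= !andbT gt_max.
    by move=> [-> ->].
  by move=> /andP.
- by move=> n; exists (- n%:R).
- apply/seteqP; split => // x _; exists (Num.truncn `|x|).+1 => //=.
  rewrite in_itv /= andbT ltrNl; apply: le_lt_trans (truncnS_gt _).
  by rewrite -normrN ler_norm.
- move=> _ [a ->]; rewrite -[`]a, +oo[%classic]setCK setCitvr.
  have m1C := probability_setC (distribution nu Xk) (measurable_itv `]-oo, a]).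
  have m2C := probability_setC (uniform_prob (@ltr01 R)) (measurable_itv `]-oo, a]).
  apply: etrans m1C _; apply: etrans (esym m2C).
  by congr (1 - _)%E; exact: nu_u.
- by move=> n; apply: le_lt_trans (probability_le1 _ _) (ltry 1).
Qed.

End marginals.

(** * Minimizers of uniformly close problems *)

Lemma cvg_increasing_seq (phi : nat -> nat) :
  increasing_seq phi -> phi k @[k --> \oo] --> \oo.
Proof.
move=> phi_inc A [N _ NA]; exists N => // k /= Nk.
apply: NA => /=; apply: leq_trans Nk _.
elim: k => // k IH; apply: leq_ltn_trans IH _.
by rewrite ltnNge -leEnat phi_inc ltnn.
Qed.

Section copula_integrals.
Context (R : realType) (d : nat).
Implicit Types (h g : 'rV[R]_d -> R) (C : 'rV[R]_d -> R).

Lemma copula_integralE h C :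
  (copula_measure C).-integrable unit_cube (EFin \o h) ->
  copula_integral h C = (\int[copula_measure C]_(x in unit_cube) h x)%:E.
Proof.
move=> ih; rewrite /copula_integral /Rintegral fineK//.
by apply: integrable_fin_num ih; exact: measurable_unit_cube.
Qed.

Lemma copula_subsequence (C_ : nat -> 'rV[R]_d -> R) :
  (forall n, (1 <= n)%N -> is_copula (C_ n)) ->
  exists (phi : nat -> nat) C, [/\ increasing_seq phi, (1 <= phi 0)%N,
    copula_weak_cvg (fun k => C_ (phi k)) C & is_copula C].
Proof.
move=> copC.
(* [C_ 0] need not be a copula; the shift is undone by taking [(phi k).+1] as the subsequence. *)
pose mu n := copula_measure (C_ n.+1).
have unif n : uniform_marginals (mu n) by exact: (copula_measureP (copC n.+1 _)).1.
have [|phi [nu [phi_inc phi0 nu1 mu_nu]]] := @prokhorov_cube R d mu.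
  by move=> n; exact: uniform_marginals_cube.
have unif_nu : uniform_marginals nu.
  move=> k A mA; apply: (@uniform_marginal_limit R d k (fun n => mu (phi n))) => //.
have [C [copC' nuC]] := copula_of_uniform_marginals unif_nu.
exists (fun k => (phi k).+1), C; split => // h h_cont.
have int_h (mu' : probability (borelRd R d) R) := unit_cube_integrable h_cont mu'.
(* [copula_measure C] is a chosen measure; uniqueness identifies it with [nu] on measurable sets. *)
have -> : copula_integral h C = (\int[nu]_(x in unit_cube) h x)%:E.
  rewrite copula_integralE//; congr (fine _)%:E.
  apply: eq_measure_integral => A mA _.
  exact: copula_measure_unique (copula_measureP copC') nuC mA.
rewrite (_ : (fun k => copula_integral h _) =
    EFin \o (fun k => \int[mu (phi k)]_(x in unit_cube) h x)).
  by apply: cvg_comp (mu_nu h h_cont) _.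
by apply/funext => k; rewrite copula_integralE.
Qed.

Section uniform_approximation.
Context (f : 'rV[R]_d -> R) (F : nat -> 'rV[R]_d -> R) (C_ : nat -> 'rV[R]_d -> R).
Hypothesis f_cont : {within unit_cube, continuous f}.
Hypothesis F_int : forall n (mu : probability (borelRd R d) R),
  mu.-integrable unit_cube (EFin \o F n).
Hypothesis F_close : forall e, 0 < e -> \forall n \near \oo,
  forall x, half_open_cube x -> `|F n x - f x| <= e.
Hypothesis C_min : forall n, (1 <= n)%N -> is_minimizer (F n) (C_ n).

Let J g C := \int[copula_measure C]_(x in unit_cube) g x.

Let J_f C : copula_integral f C = (J f C)%:E.
Proof. by rewrite copula_integralE//; exact: unit_cube_integrable. Qed.

Let J_F n C : copula_integral (F n) C = (J (F n) C)%:E.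
Proof. by rewrite copula_integralE. Qed.

(** Every copula gives the half-open cube full mass, so the rank is independent of the copula and
    the bound applies to the varying [C_ n]. *)
Let J_close e : 0 < e -> \forall n \near \oo, forall C, is_copula C ->
  `|J (F n) C - J f C| <= e.
Proof.
move=> e0; have := F_close e0; apply: filterS => n Fe C copC.
apply: (@Rintegral_close _ _ _ (copula_measure C) _ (@half_open_cube R d)) => //.
- exact: measurable_unit_cube.
- exact: measurable_half_open_cube.
- exact: half_open_cube_sub.
- exact/uniform_marginals_half_open_cube/(copula_measureP copC).1.
- exact: unit_cube_integrable.
Qed.

Let J_C_min n C : (1 <= n)%N -> is_copula C -> J (F n) (C_ n) <= J (F n) C.
Proof.
by move=> n1 copC; rewrite -lee_fin -!J_F; exact: (C_min n1).2.
Qed.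

(** For n = [phi k] large, J f (C_ n) <= J (F n) (C_ n) + e/2 <= J (F n) C' + e/2 <= J f C' + e. The
    left side tends to J f C by weak convergence. *)
Lemma minimizer_subsequence : exists (phi : nat -> nat) C,
  [/\ increasing_seq phi, (1 <= phi 0)%N,
      copula_weak_cvg (fun k => C_ (phi k)) C & is_minimizer f C].
Proof.
have [phi [C [phi_inc phi0 wC copC]]] :=
  copula_subsequence (fun n n1 => (C_min n1).1).
exists phi, C; split => //; split => // C' copC'.
have phi1 k : (1 <= phi k)%N by rewrite (leq_trans phi0)// phi_inc.
have JC : J f (C_ (phi k)) @[k --> \oo] --> J f C.
  have := wC f f_cont; rewrite J_f => /fine_cvgP[_].
  by under eq_fun do rewrite /= J_f.
rewrite !J_f lee_fin; apply/ler_addgt0Pr => e e0.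
have e2 : 0 < e / 2 by rewrite divr_gt0.
rewrite -(cvg_lim _ JC)//; apply: limr_le; first exact: cvgP JC.
near=> k.
have close C0 : is_copula C0 -> `|J (F (phi k)) C0 - J f C0| <= e / 2.
  by move: C0; near: k; exact: cvg_increasing_seq phi_inc _ (J_close e2).
have := close _ (C_min (phi1 k)).1; have := close _ copC'.
have := J_C_min (phi1 k) copC'.
rewrite !ler_norml => h1 /andP[_ h2] /andP[h3 _]; lra.
Unshelve. all: by end_near. Qed.

(** The infimum is attained at a weak limit C. Minimality of [C_ n] gives J (F n) (C_ n) <= J f C +
    e, minimality of C gives J f C <= J (F n) (C_ n) + e, so the whole sequence converges. *)
Lemma cvg_min_integral :
  copula_integral (F n) (C_ n) @[n --> \oo] -->
    ereal_inf [set copula_integral f C | C in [set C | is_copula C]].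
Proof.
have [_ [C [_ _ _ [copC Cmin]]]] := minimizer_subsequence.
have -> : ereal_inf [set copula_integral f C | C in [set C | is_copula C]] =
    (J f C)%:E.
  apply/eqP; rewrite eq_le; apply/andP; split.
    by apply: ereal_inf_lbound; exists C => //; exact: J_f.
  by apply: le_ereal_inf_tmp => _ [C' copC' <-]; rewrite -J_f; exact: Cmin.
under eq_fun do rewrite J_F.
apply: cvg_EFin; first exact: nearW.
apply/cvgrPdist_le => e e0; near=> n => /=.
have n1 : (1 <= n)%N by near: n; exact: nbhs_infty_ge.
have close C0 : is_copula C0 -> `|J (F n) C0 - J f C0| <= e.
  by move: C0; near: n; exact: J_close.
have := close _ (C_min n1).1; have := close _ copC.
have := J_C_min n1 copC.
have := Cmin _ (C_min n1).1; rewrite !J_f lee_fin.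
rewrite !ler_norml => h0 h1 /andP[_ h2] /andP[h3 h4]; apply/andP; split; lra.
Unshelve. all: by end_near. Qed.

End uniform_approximation.
End copula_integrals.

(** * Step functions *)

Section step_functions.
Context (R : realType) (d : nat).

(** Common form of [fmax] and [fmin], so that integrability and closeness are proved once. *)
Definition cell_step (n : nat) (g : {ffun 'I_d -> 'I_n} -> R) (x : 'rV[R]_d) : R :=
  if [pick i : {ffun 'I_d -> 'I_n} | x \in cell i] is Some i then g i else 0.

Lemma measurable_cell n (i : {ffun 'I_d -> 'I_n}) :
  measurable (cell i : set (borelRd R d)).
Proof.
have := @measurable_box R d (fun k => `[(i k)%:R / n%:R, (i k).+1%:R / n%:R[%classic)
  (fun=> measurable_itv _).
by congr measurable; apply/seteqP; split => x /= h k; have := h k; rewrite in_itv.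
Qed.

Lemma cell_step_integrable n (g : {ffun 'I_d -> 'I_n} -> R)
    (mu : probability (borelRd R d) R) :
  mu.-integrable unit_cube (EFin \o cell_step g).
Proof.
pose X (x : 'rV[R]_d) := [ffun i : {ffun 'I_d -> 'I_n} => x \in cell i].
pose G (v : {ffun {ffun 'I_d -> 'I_n} -> bool}) :=
  if [pick i | v i] is Some i then g i else 0.
(* The step function factors through the finite vector of cell memberships. *)
have -> : cell_step g = G \o X.
  apply/funext => x; rewrite /cell_step /G /X /=.
  by congr (if _ is Some i then _ else _); apply: eq_pick => i; rewrite ffunE.
apply: (@integrableS _ _ _ mu setT) => //; first exact: measurable_unit_cube.
have [|int_GX _] := @Rintegral_simple R _ _ mu _ X G; last exact: int_GX.
move=> v; rewrite (_ : mkset _ = [set x | forall i, (x \in cell i) = v i]).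
  apply: (@measurable_forall _ (borelRd R d) _
    (fun i => [set x : 'rV[R]_d | (x \in cell i) = v i])) => i.
  case: (v i).
    rewrite (_ : mkset _ = cell i); first exact: measurable_cell.
    by apply/seteqP; split => x /=; [exact: set_mem|exact: mem_set].
  rewrite (_ : mkset _ = ~` cell i).
    by apply: measurableC; exact: measurable_cell.
  apply/seteqP; split => x /=; first by move/negbT; rewrite notin_setE.
  by move=> xi; apply/negbTE; rewrite notin_setE.
apply/seteqP; split => x /=; first by move=> <- i; rewrite ffunE.
by move=> h; apply/ffunP => i; rewrite ffunE h.
Qed.

Lemma cell_sub_unit_cube n (i : {ffun 'I_d -> 'I_n}) :
  (cell i : set 'rV[R]_d) `<=` unit_cube.
Proof.
move=> x xi k; have /andP[h1 h2] := xi k.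
have n0 : (0 < n)%N.
  exact: leq_ltn_trans (ltn_ord (i k)).
rewrite (le_trans _ h1) ?divr_ge0//=; apply: le_trans (ltW h2) _.
by rewrite ler_pdivrMr ?ltr0n// mul1r ler_nat.
Qed.

Lemma cell_close n (i : {ffun 'I_d -> 'I_n}) (x y : 'rV[R]_d) k :
  cell i x -> cell i y -> `|x ord0 k - y ord0 k| < n%:R^-1.
Proof.
move=> /(_ k)/andP[x1 x2] /(_ k)/andP[y1 y2].
have E : (i k).+1%:R / n%:R = (i k)%:R / n%:R + n%:R^-1 :> R.
  by rewrite -natr1 mulrDl mul1r.
by rewrite E in x2 y2; rewrite ltr_norml; apply/andP; split; lra.
Qed.

Lemma half_open_cube_cell n (x : 'rV[R]_d) : (1 <= n)%N -> half_open_cube x ->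
  exists i : {ffun 'I_d -> 'I_n}, cell i x.
Proof.
move=> n1 x01; have nR : (0 : R) < n%:R by rewrite ltr0n.
have xn k : (Num.truncn (n%:R * x ord0 k) < n)%N.
  have /andP[x0 x1] := x01 k.
  rewrite -(ltr_nat R).
  have /andP[h _] := truncn_itv (mulr_ge0 (ltW nR) x0).
  by apply: le_lt_trans h _; rewrite gtr_pMr.
(* The index is the integer part of n x_k, which is below n because x_k < 1. *)
exists [ffun k => Ordinal (xn k)] => k; rewrite ffunE /=.
have /andP[x0 x1] := x01 k.
have /andP[h1 h2] := truncn_itv (mulr_ge0 (ltW nR) x0).
by rewrite ler_pdivrMr// ltr_pdivlMr// ![x _ _ * _]mulrC h1 h2.
Qed.

(** Cells have side 1/n, so uniform continuity bounds the variation of [f] on a cell by [e]. The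
    condition on [g] captures what supremum and infimum share. *)
Lemma cell_step_close (f : 'rV[R]_d -> R)
    (g : forall n, {ffun 'I_d -> 'I_n} -> R) :
  {within unit_cube, continuous f} ->
  (forall n (i : {ffun 'I_d -> 'I_n}) x e, cell i x ->
    (forall y, cell i y -> `|f x - f y| < e) -> `|g n i - f x| <= e) ->
  forall e, 0 < e -> \forall n \near \oo,
    forall x, half_open_cube x -> `|cell_step (g n) x - f x| <= e.
Proof.
move=> f_cont g_close e e0; have [r r0 hr] := unit_cube_unif_continuous f_cont e0.
near=> n => x x01.
have n1 : (1 <= n)%N by near: n; exact: nbhs_infty_ge.
have nr : (n%:R^-1 : R) < r.
  rewrite invf_plt ?posrE ?ltr0n//; near: n; exact: nbhs_infty_gtr.
rewrite /cell_step; case: pickP => [i /set_mem xi|no].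
  apply: g_close (xi) _ => y yi.
  apply: hr => [| |k]; [exact: (cell_sub_unit_cube xi)|exact: (cell_sub_unit_cube yi)|].
  exact: lt_trans (cell_close k xi yi) nr.
have [i xi] := half_open_cube_cell n1 x01.
by have := no i; rewrite mem_set.
Unshelve. all: by end_near. Qed.

Lemma sup_cell_close (f : 'rV[R]_d -> R) n (i : {ffun 'I_d -> 'I_n}) x e :
  cell i x -> (forall y, cell i y -> `|f x - f y| < e) ->
  `|sup (f @` cell i) - f x| <= e.
Proof.
move=> xi fe.
have ub : ubound (f @` cell i) (f x + e).
  by move=> _ [y yi <-]; have := fe y yi; rewrite ltr_norml => /andP[? ?]; lra.
have h1 : f x <= sup (f @` cell i).
  by apply: ub_le_sup; [exists (f x + e)|exists x].
have h2 : sup (f @` cell i) <= f x + e by apply: ge_sup => //; exists (f x), x.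
by rewrite ger0_norm ?subr_ge0// lerBlDl.
Qed.

Lemma inf_cell_close (f : 'rV[R]_d -> R) n (i : {ffun 'I_d -> 'I_n}) x e :
  cell i x -> (forall y, cell i y -> `|f x - f y| < e) ->
  `|inf (f @` cell i) - f x| <= e.
Proof.
move=> xi fe.
have lb : lbound (f @` cell i) (f x - e).
  by move=> _ [y yi <-]; have := fe y yi; rewrite ltr_norml => /andP[? ?]; lra.
have h1 : inf (f @` cell i) <= f x.
  by apply: ge_inf; [exists (f x - e)|exists x].
have h2 : f x - e <= inf (f @` cell i) by apply: lb_le_inf => //; exists (f x), x.
by rewrite distrC ger0_norm ?subr_ge0// lerBlDr -lerBlDl.
Qed.

End step_functions.

Theorem theorem3p2 (R : realType) (d : nat) (f : 'rV[R]_d -> R)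
    (Cmax Cmin : nat -> 'rV[R]_d -> R)
    (d_ge2 : (2 <= d)%N)
    (f_cont : {within unit_cube, continuous f})
    (f_bound : bounded_by_sum f)
    (Cmax_min : forall n, (1 <= n)%N -> is_minimizer (fmax f n) (Cmax n))
    (Cmin_min : forall n, (1 <= n)%N -> is_minimizer (fmin f n) (Cmin n)) :
  [/\ copula_integral (fmin f n) (Cmin n) @[n --> \oo] -->
        ereal_inf [set copula_integral f C | C in [set C | is_copula C]],
      copula_integral (fmax f n) (Cmax n) @[n --> \oo] -->
        ereal_inf [set copula_integral f C | C in [set C | is_copula C]],
      (exists (phi : nat -> nat) (C : 'rV[R]_d -> R),
         [/\ increasing_seq phi, (1 <= phi 0)%N,
             copula_weak_cvg (fun k => Cmax (phi k)) C & is_minimizer f C]) &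
      (exists (phi : nat -> nat) (C : 'rV[R]_d -> R),
         [/\ increasing_seq phi, (1 <= phi 0)%N,
             copula_weak_cvg (fun k => Cmin (phi k)) C & is_minimizer f C])].
Proof.
(* [fmax f n] and [fmin f n] unfold to [cell_step] of the suprema and infima over cells, so both
   serve as the approximating sequence. *)
have max_int n := @cell_step_integrable R d n (fun i => sup (f @` cell i)).
have min_int n := @cell_step_integrable R d n (fun i => inf (f @` cell i)).
have max_close := cell_step_close f_cont (@sup_cell_close R d f).
have min_close := cell_step_close f_cont (@inf_cell_close R d f).
split.
- exact: (cvg_min_integral f_cont min_int min_close Cmin_min).
- exact: (cvg_min_integral f_cont max_int max_close Cmax_min).
- exact: (minimizer_subsequence f_cont max_int max_close Cmax_min).
- exact: (minimizer_subsequence f_cont min_int min_close Cmin_min).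
Qed.
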